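(* Fix an integer $t \ge 3$. Let $n \ge 1$ and $d \ge 1$ be positive integers, and write $n = q(d+1)+r$ with $q, r$ integers and $0 \le r \le d$. Then any graph on $n$ vertices with maximum degree $d$ has at most $$q\binom{d+1}{t}+\binom{r}{t}$$ cliques of size $t$.
   Context: Graphs are finite, simple and undirected (no loops, no multiple edges). The maximum degree of a graph is the maximum of the degrees of its vertices. A clique of size $t$ is a set of $t$ pairwise adjacent vertices (not necessarily a maximal clique; cliques are counted as unordered sets). The binomial coefficient $\binom{m}{t}$ is $0$ for integers $0 \le m < t$. *)

(* Defs.v *)
From mathcomp Require Import all_boot.

Set Implicit Arguments.
Unset Strict Implicit.
Unset Printing Implicit Defensive.

(* A finite simple graph is a symmetric irreflexive adjacency relation
   [e : rel T] on a vertex type [T : finType].  Symmetry and irreflexivity are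
   not bundled: they appear as hypotheses of the statements. *)
Section Graph.

Variables (T : finType) (e : rel T).

Definition degree (v : T) : nat := #|[set w | e v w]|.

(* Equal to 0 when [T] is empty. *)
Definition max_degree : nat := \max_(v : T) degree v.

Definition is_clique (A : {set T}) : bool :=
  [forall x in A, forall y in A, (x != y) ==> e x y].

Definition cliques (t : nat) : {set {set T}} :=
  [set A | is_clique A & #|A| == t].

End Graph.

(* Main.v *)
Require Import Defs.
From mathcomp Require Import all_boot zify.

(** The statement is proved for all induced subgraphs [A] of the graph at once,
    by induction on the number of vertices: find a vertex [z] of [A] such that
    deleting its closed neighbourhood in [A] destroys at most as many
    [t]-cliques as a complete graph on that neighbourhood would contain
    ([exists_cheap_vertex]), delete it, and check that the bound absorbs the
    deletion ([clique_bound_rec]; this is convexity of the binomial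
    coefficient).

    The vertex [z] comes from averaging (an argument of Chase for [t = 3], which
    works unchanged for every [t >= 3]).  Summed over [z], the numbers of
    destroyed cliques count the pairs [(z, K)] with [K] a [t]-clique that meets
    the closed neighbourhood of [z]; the sizes allowed count the pairs [(v, U)]
    with [U] a [t]-set contained in the closed neighbourhood of [v].  Both kinds
    of pairs are compared after grouping them by the union [S] of the vertex and
    the set.  Within one group the first kind is never more frequent than the
    second ([leq_touching_dominated]): a pair [(z, K)] that is not itself of
    the second kind has a vertex [y] of [K] not adjacent to [z], and any other
    clique of the group must avoid [y], so the group has at most two cliques.
    Conversely each vertex of [K] adjacent to [z] is adjacent to all the rest
    of [S]; there is at least one, because [K] meets the neighbourhood of [z],
    and when there is a second clique all [t - 1 >= 2] vertices of [K] other
    than [y] qualify. *)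

Set Implicit Arguments.
Unset Strict Implicit.
Unset Printing Implicit Defensive.

(** * Convexity of the bound *)

(** [x |-> 'C(x, t)] is convex: its increments ['C(x, t.-1)] grow with [x]. *)
Lemma bin_convex t x a b :
  'C(x + a, t) + 'C(x + b, t) <= 'C(x, t) + 'C(x + a + b, t).
Proof.
case: t => [|s]; first by rewrite !bin0.
elim: b => [|b IHb]; first by rewrite !addn0 addnC.
rewrite !addnS !binS.
have : 'C(x + b, s) <= 'C(x + a + b, s) by apply: leq_bin2l; lia.
by move: IHb; lia.
Qed.

Definition clique_bound d t n :=
  n %/ d.+1 * 'C(d.+1, t) + 'C(n %% d.+1, t).

Lemma clique_boundE d t q r :
  r <= d -> clique_bound d t (q * d.+1 + r) = q * 'C(d.+1, t) + 'C(r, t).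
Proof.
move=> le_rd.
by rewrite /clique_bound divnMDl // modnMDl divn_small ?modn_small ?addn0.
Qed.

(** A part of size [m] is traded against the remainder [r] of [n]: either it
    fits into the remainder, or it is completed to a full block of size
    [d.+1]. *)
Lemma clique_bound_rec d t n m :
  0 < t -> m <= d.+1 -> m <= n ->
  'C(m, t) + clique_bound d t (n - m) <= clique_bound d t n.
Proof.
move=> t_gt0 le_md le_mn.
have le_rd : n %% d.+1 <= d by rewrite -ltnS ltn_mod.
rewrite {2}(divn_eq n d.+1) clique_boundE //.
have def_n := divn_eq n d.+1; move: def_n le_rd.
move: (n %/ d.+1) (n %% d.+1) => q r def_n le_rd.
case: (leqP m r) => [le_mr | lt_rm].
  have -> : n - m = q * d.+1 + (r - m) by lia.
  rewrite clique_boundE; last by lia.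
  have := bin_convex t 0 m (r - m).
  by rewrite !add0n bin0n subnKC // (gtn_eqF t_gt0); lia.
case: q def_n => [|q] def_n; first by lia.
have -> : n - m = q * d.+1 + (d.+1 + r - m) by move: def_n; rewrite mulSn; lia.
rewrite clique_boundE; last by lia.
have := bin_convex t r (m - r) (d.+1 - m).
have -> : r + (m - r) = m by lia.
have -> : r + (d.+1 - m) = d.+1 + r - m by lia.
have -> : m + (d.+1 - m) = d.+1 by lia.
by rewrite mulSn; lia.
Qed.

(** * Cliques meeting a closed neighbourhood *)

(** Two such sums can then be compared group by group, where a group involves
    only the few vertices of [S]. *)
Lemma sum_card_by_union (T : finType) (A : {set T})
    (F : T -> {set {set T}}) :
  \sum_(z in A) #|F z| =
  \sum_(S : {set T})
    #|[set p : T * {set T} |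
        [&& p.1 \in A, p.2 \in F p.1 & p.1 |: p.2 == S]]|.
Proof.
under eq_bigr do rewrite -sum1_card.
rewrite pair_big_dep /= (partition_big (fun p => p.1 |: p.2) xpredT) //=.
apply: eq_bigr => S _; rewrite sum1dep_card.
by apply: eq_card => p; rewrite !inE andbA.
Qed.

Section ClosedNeighbourhood.

Variables (T : finType) (e : rel T).
Hypothesis e_sym : symmetric e.

Definition closed_nbhd (v : T) : {set T} := v |: [set w | e v w].

Lemma closed_nbhd_sym v w : (v \in closed_nbhd w) = (w \in closed_nbhd v).
Proof. by rewrite !inE eq_sym e_sym. Qed.

Lemma card_closed_nbhd v : #|closed_nbhd v| <= (max_degree e).+1.
Proof.
rewrite cardsU1 -add1n leq_add ?leq_b1 //.
by rewrite /max_degree; apply: (@leq_bigmax _ (degree e)).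
Qed.

Lemma clique_closed_nbhd (K : {set T}) x :
  is_clique e K -> x \in K -> K \subset closed_nbhd x.
Proof.
move=> /forall_inP/(_ x) cK Kx; apply/subsetP=> y Ky.
have /forall_inP/(_ y Ky)/implyP := cK Kx.
by rewrite !inE eq_sym; case: eqP => //= _; apply.
Qed.

Variable t : nat.

Definition touching (A : {set T}) (z : T) : {set {set T}} :=
  [set K in cliques e t | (K \subset A) && ~~ [disjoint K & closed_nbhd z]].

Definition dominated (A : {set T}) (v : T) : {set {set T}} :=
  [set U : {set T} | (U \subset A :&: closed_nbhd v) & #|U| == t].

Definition touching_pairs (A S : {set T}) : {set T * {set T}} :=
  [set p | [&& p.1 \in A, p.2 \in touching A p.1 & p.1 |: p.2 == S]].

Definition dominated_pairs (A S : {set T}) : {set T * {set T}} :=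
  [set p | [&& p.1 \in A, p.2 \in dominated A p.1 & p.1 |: p.2 == S]].

Lemma touching_pairsP (A S : {set T}) z (K : {set T}) :
  reflect [/\ z \in A, K \subset A, is_clique e K /\ #|K| = t,
             z |: K = S & exists2 w, w \in K & w \in closed_nbhd z]
          ((z, K) \in touching_pairs A S).
Proof.
rewrite !inE /=; apply: (iffP idP).
  case/and3P=> Az /andP[/andP[cK /eqP tK]] /andP[sKA].
  rewrite disjoint_sym => /pred0Pn[w /andP[zw Kw]] /eqP defS.
  by split=> //; exists w.
case=> -> -> [-> ->] -> [w Kw zw]; rewrite !eqxx /= andbT.
by apply/pred0Pn; exists w; apply/andP.
Qed.

Lemma dominated_pairsP (A S : {set T}) v (U : {set T}) :
  reflect [/\ v \in A, U \subset A, U \subset closed_nbhd v, #|U| = t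
             & v |: U = S]
          ((v, U) \in dominated_pairs A S).
Proof.
rewrite !inE /= subsetI; apply: (iffP idP).
  by case/and3P=> ? /andP[/andP[? ?] /eqP ?] /eqP ?.
by case=> -> -> -> -> ->; rewrite !eqxx.
Qed.

Hypothesis t_ge3 : 2 < t.

(** For [t = 2] this fails on a path with three vertices: each of its two edges
    meets the neighbourhood of the opposite end, but only the middle vertex is
    adjacent to the other two. *)
Lemma leq_touching_dominated A S :
  #|touching_pairs A S| <= #|dominated_pairs A S|.
Proof.
have [/subset_leq_card//|] :=
  boolP (touching_pairs A S \subset dominated_pairs A S).
case/subsetPn=> -[z K] /touching_pairsP[Az sKA [cK tK] defS [w Kw zw]] notR.
have [y Ky zy] : exists2 y, y \in K & y \notin closed_nbhd z.
  apply/subsetPn; apply: contra notR => sKz.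
  by apply/dominated_pairsP.
have zK : z \notin K.
  by apply: contra zy => /(clique_closed_nbhd cK)/subsetP; apply.
have cardS : #|S| = t.+1 by rewrite -defS cardsU1 zK tK.
have sSA : S \subset A by rewrite -defS subUset sub1set Az.
have Sy : y \in S by rewrite -defS !inE Ky orbT.
have Sz : z \in S by rewrite -defS !inE eqxx.
pose W := K :&: closed_nbhd z.
(* A vertex of [W] is adjacent to the rest of [K] and to [z], so it dominates
   the rest of [S]. *)
have W_dom : #|W| <= #|dominated_pairs A S|.
  rewrite -(card_imset _ (f := fun v => (v, S :\ v))); last by move=> ? ? [].
  apply/subset_leq_card/subsetP=> _ /imsetP[v /setIP[Kv zv] ->].
  have Sv : v \in S by rewrite -defS !inE Kv orbT.
  apply/dominated_pairsP; split.
  - exact: subsetP sKA _ Kv.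
  - exact: subset_trans (subsetDl _ _) sSA.
  - apply: subset_trans (subsetDl _ _) _.
    by rewrite -defS subUset sub1set closed_nbhd_sym zv clique_closed_nbhd.
  - by move: (cardsD1 v S); rewrite Sv cardS add1n => -[].
  - exact: setD1K.
apply: leq_trans W_dom.
(* A second clique of the group omits one vertex of [S]; it contains [z], hence
   the omitted vertex is [y]. *)
have only2 p : p \in touching_pairs A S -> p = (z, K) \/ p = (y, S :\ y).
  case: p => x M /touching_pairsP[_ _ [cM tM] defS' _].
  have xM : x \notin M.
    by move/eqP: cardS; rewrite -defS' cardsU1 tM -add1n eqn_add2r eqb1.
  have defM : M = S :\ x by rewrite -defS' setU1K.
  have [eq_xz | ne_xz] := eqVneq x z.
    by left; rewrite defM eq_xz -defS setU1K.
  right; suff -> : y = x by rewrite defM.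
  apply/eqP; apply: contraR zy => ne_yx.
  apply: (subsetP (clique_closed_nbhd cM _)); rewrite defM in_setD1.
    by rewrite eq_sym ne_xz.
  by rewrite ne_yx.
have [inL | notL] := boolP ((y, S :\ y) \in touching_pairs A S); last first.
  apply: (@leq_trans 1); last by apply/card_gt0P; exists w; apply/setIP.
  rewrite -(cards1 (z, K)); apply/subset_leq_card/subsetP=> p Lp.
  rewrite inE; case: (only2 p Lp) => [-> // | def_p].
  by rewrite -def_p Lp in notL.
apply: (@leq_trans 2).
  rewrite (leq_trans _ (_ : #|[set (z, K); (y, S :\ y)]| <= 2)) //.
    apply/subset_leq_card/subsetP=> p /only2[] ->; by rewrite !inE eqxx ?orbT.
  by rewrite cards2; case: eqP.
(* Now all of [K] except [y] lies in a clique together with [z]. *)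
have sKW : K :\ y \subset W.
  rewrite subsetI subsetDl /=.
  have [_ _ [cM _] _ _] := touching_pairsP _ _ _ _ inL.
  apply: subset_trans (clique_closed_nbhd cM _).
    by rewrite setSD // -defS subsetUr.
  by rewrite !inE Sz andbT; apply: contraNneq zK => ->.
apply: leq_trans (subset_leq_card sKW).
by move: (cardsD1 y K) t_ge3; rewrite Ky tK => ->; rewrite add1n ltnS.
Qed.

(** If every vertex of [A] violated the bound, summing over [A] would
    contradict the comparison of pairs. *)
Lemma exists_cheap_vertex (A : {set T}) :
  A != set0 ->
  exists2 z, z \in A & #|touching A z| <= 'C(#|A :&: closed_nbhd z|, t).
Proof.
case/set0Pn=> a Aa; apply/exists_inP; apply: contraT.
rewrite negb_exists_in => /forall_inP dear.
have : \sum_(z in A) #|touching A z| <= \sum_(z in A) #|dominated A z|.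
  rewrite !sum_card_by_union; apply: leq_sum => S _.
  exact: leq_touching_dominated.
rewrite leqNgt => /negP[].
have card_dom z : #|dominated A z| = 'C(#|A :&: closed_nbhd z|, t).
  exact: cards_draws.
have lt_dom z : z \in A -> #|dominated A z| < #|touching A z|.
  by move=> Az; rewrite card_dom ltnNge dear.
rewrite (bigD1 a) //= [leqRHS](bigD1 a) //= -addSn leq_add ?lt_dom //.
by apply: leq_sum => z /andP[/lt_dom/ltnW].
Qed.

(** Induction needs the cliques inside an arbitrary vertex set [A]; the bound
    stays in terms of the maximum degree of the whole graph. *)
Lemma card_cliques_sub (A : {set T}) :
  #|[set K in cliques e t | K \subset A]| <=
  clique_bound (max_degree e) t #|A|.
Proof.
have [m] := ubnP #|A|; elim: m A => // m IHm A ltAm.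
have [-> | A_neq0] := eqVneq A set0.
  rewrite (eq_card0 (_ : _ =i pred0)) // => K; rewrite !inE subset0.
  apply/negP=> /andP[/andP[_ /eqP tK] /eqP K0].
  by move: t_ge3; rewrite -tK K0 cards0.
have [z Az cheap] := exists_cheap_vertex A_neq0.
have Nz : z \in A :&: closed_nbhd z by rewrite !inE Az eqxx.
have N_gt0 : 0 < #|A :&: closed_nbhd z| by apply/card_gt0P; exists z.
have cardD : #|A :\: closed_nbhd z| = #|A| - #|A :&: closed_nbhd z|.
  by rewrite cardsD.
have le_NA : #|A :&: closed_nbhd z| <= #|A| by rewrite subset_leq_card ?subsetIl.
have le_Nd : #|A :&: closed_nbhd z| <= (max_degree e).+1.
  by apply: leq_trans (card_closed_nbhd z); rewrite subset_leq_card ?subsetIr.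
apply: leq_trans (clique_bound_rec _ le_Nd le_NA); last by lia.
apply: leq_trans (leq_add cheap _); last first.
  by rewrite -cardD; apply: IHm; rewrite cardD; lia.
apply: leq_trans (leq_card_setU _ _).
apply/subset_leq_card/subsetP=> K; rewrite inE => /andP[tK sKA].
rewrite inE [K \in touching _ _]inE [X in _ || X]inE tK sKA subsetD sKA /=.
by rewrite orNb.
Qed.

End ClosedNeighbourhood.

Theorem theorem2 (t : nat) (ht : 3 <= t)
    (n d : nat) (hn : 1 <= n) (hd : 1 <= d)
    (q r : nat) (hqr : n = q * d.+1 + r) (hr : r <= d)
    (T : finType) (hT : #|T| = n)
    (e : rel T) (e_sym : symmetric e) (e_irr : irreflexive e)
    (hdeg : max_degree e = d) :
  #|cliques e t| <= q * 'C(d.+1, t) + 'C(r, t).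
Proof.
have := card_cliques_sub e_sym ht [set: T].
rewrite cardsT hT hdeg hqr clique_boundE //.
apply: leq_trans; apply/subset_leq_card/subsetP=> K tK.
by rewrite inE tK subsetT.
Qed.
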